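(* Let $m\ge 1$, let $V\in C(\mathbb{T}^n)$ with $\min_{\mathbb{T}^n}V=0$, and let $f:\mathbb{R}\to\mathbb{R}$ be convex with $f(r)=0$ for $r\le 0$ and $f(r)>0$ for $r>0$. Let $M_V=\{x\in\mathbb{T}^n: V(x)=\min_{\mathbb{T}^n}V=0\}$. If $u_1,u_2\in C(\mathbb{T}^n)$ are two viscosity solutions of $$|Du|^m-V(x)+f(u)=0\quad\text{in }\mathbb{T}^n$$ and $u_1=u_2$ on $M_V$, then $u_1=u_2$ on $\mathbb{T}^n$.
   Context: $\mathbb{T}^n=\mathbb{R}^n/\mathbb{Z}^n$ is the flat $n$-dimensional torus. Solutions are in the viscosity sense. *)

(* Defs.v *)
From HB Require Import structures.
From mathcomp Require Import all_boot all_order all_algebra.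
From mathcomp Require Import all_classical all_reals all_analysis.

Set Implicit Arguments.
Unset Strict Implicit.
Unset Printing Implicit Defensive.

Import Order.TTheory GRing.Theory Num.Theory.
Import numFieldNormedType.Exports.

Local Open Scope classical_set_scope.
Local Open Scope ring_scope.
Local Open Scope quotient_scope.

Section Torus.
Context {R : realType} {n : nat}.

Definition int_congr (x y : 'rV[R]_n) : bool :=
  [forall i, x 0 i - y 0 i \is a Num.int].

Lemma int_congr_refl : reflexive int_congr.
Proof. by move=> x; apply/forallP => i; rewrite subrr. Qed.

Lemma int_congr_sym : symmetric int_congr.
Proof. by move=> x y; apply: eq_forallb => i; rewrite -rpredN opprB. Qed.

Lemma int_congr_trans : transitive int_congr.
Proof.
move=> y x z /forallP xy /forallP yz; apply/forallP => i.
by rewrite -(subrKA (y 0 i)) rpredD.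
Qed.

Canonical int_congr_equiv :=
  EquivRel int_congr int_congr_refl int_congr_sym int_congr_trans.

End Torus.

Definition torus (R : realType) (n : nat) : Type :=
  {eq_quot (@int_congr_equiv R n)}.

HB.instance Definition _ (R : realType) (n : nat) :=
  Topological.copy (torus R n) (quotient_topology (torus R n)).
HB.instance Definition _ (R : realType) (n : nat) := Quotient.on (torus R n).

Lemma torus_eqP {R : realType} {n : nat} (x y : 'rV[R]_n) :
  reflect (\pi_(torus R n) x = \pi_(torus R n) y) (int_congr x y).
Proof. exact: (@eqmodP _ int_congr_equiv). Qed.

Section ViscositySolutions.
Context {R : realType} {n : nat}.
Implicit Types (u phi V : torus R n -> R) (H : torus R n -> R -> 'rV[R]_n -> R).

Definition torus_lift phi : 'rV[R]_n -> R :=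
  phi \o \pi_(torus R n).

(* A function on the torus is of class C^1 iff its Z^n-periodic lift is. *)
Definition C1 phi : Prop :=
  (forall y, differentiable (torus_lift phi) y) /\
  (forall v, continuous (fun y => 'D_v (torus_lift phi) y)).

(* The choice of the representative is immaterial: see gradE below. *)
Definition grad phi (x : torus R n) : 'rV[R]_n :=
  \row_(i < n) 'D_(delta_mx 0 i) (torus_lift phi) (repr x).

Lemma gradE phi (y : 'rV[R]_n) :
  grad phi (\pi y) = \row_(i < n) 'D_(delta_mx 0 i) (torus_lift phi) y.
Proof.
have yr : int_congr (repr (\pi_(torus R n) y)) y.
  by apply/torus_eqP; rewrite reprK.
have E z : torus_lift phi (z + repr (\pi_(torus R n) y)) = torus_lift phi (z + y).
  congr (phi _); apply/torus_eqP/forallP => j.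
  rewrite [X in X - _]mxE [X in _ - X]mxE opprD addrACA subrr add0r.
  exact: (forallP yr).
apply/rowP => i; rewrite !mxE.
suff F : torus_lift phi \o shift (repr (\pi_(torus R n) y)) =
         torus_lift phi \o shift y.
  by rewrite /derive F -[X in torus_lift phi X]add0r E add0r.
by apply/funext => z; exact: E.
Qed.

(* Norms on 'rV[R]_n in the library are sup norms. *)
Definition euclidean_norm (p : 'rV[R]_n) : R :=
  Num.sqrt (\sum_(i < n) p 0 i ^+ 2).

(* Viscosity notions for the equation H(x, u, Du) = 0 on the torus. *)
Definition viscosity_subsolution H u : Prop :=
  forall phi, C1 phi -> forall x,
    (\forall y \near x, u y - phi y <= u x - phi x) ->
    H x (u x) (grad phi x) <= 0.

Definition viscosity_supersolution H u : Prop :=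
  forall phi, C1 phi -> forall x,
    (\forall y \near x, u x - phi x <= u y - phi y) ->
    0 <= H x (u x) (grad phi x).

Definition viscosity_solution H u : Prop :=
  viscosity_subsolution H u /\ viscosity_supersolution H u.

Definition is_minimum V (c : R) : Prop :=
  (exists x, V x = c) /\ (forall x, c <= V x).

Definition minimizers V : set (torus R n) := [set x | is_minimum V (V x)].

End ViscositySolutions.

(* Main.v *)
(* Since f is convex and vanishes on the negative reals, the constants -C, C >= 0,
   are subsolutions, strict where V > 0.  Convexity of the Hamiltonian makes
   l u1 - (1 - l) C with 0 < l < 1 a subsolution that is strict outside M_V, and
   it lies below u2 on M_V as soon as C >= - min u1.  If it exceeded u2
   somewhere, doubling the variables would yield points x, y, closer and closer
   to each other as the penalty grows, with (1 - l) V(x) <= V(x) - V(y); by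
   compactness they would accumulate at a point of M_V where l u1 - (1 - l) C
   exceeds u2, a contradiction.  Let l tend to 1. *)
From HB Require Import structures.
Require Import Defs.
From mathcomp Require Import all_boot all_order all_algebra.
From mathcomp Require Import all_classical all_reals all_analysis.
From mathcomp Require Import ring lra.
Set Implicit Arguments.
Unset Strict Implicit.
Unset Printing Implicit Defensive.
Import Order.TTheory GRing.Theory Num.Theory.
Import numFieldNormedType.Exports.
Local Open Scope classical_set_scope.
Local Open Scope ring_scope.
Local Open Scope quotient_scope.

(** * Integer periods and the points where the cosine equals 1 *)

Lemma periodic_int (R : realType) (g : R -> R) (T x : R) (k : int) :
  periodic g T -> g (x + T * k%:~R) = g x.
Proof.
move=> gT; case: k => k.
  by rewrite -pmulrn mulr_natr periodicn.
by rewrite NegzE rmorphN/= mulrN -pmulrn mulr_natr -(periodicn gT k.+1) subrK.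
Qed.

(** With [s] the fractional part of [t], the double angle formula forces [sin (pi * s) = 0]; sine is
    positive strictly between 0 and [pi], so [s = 0]. *)
Lemma cos_2pi_eq1 (R : realType) (t : R) :
  cos (pi *+ 2 * t) = 1 -> t \is a Num.int.
Proof.
pose k := Num.floor t; pose s := t - k%:~R.
have s0 : 0 <= s by rewrite subr_ge0 floor_le.
have s1 : s < 1 by rewrite ltrBlDl; have := floorD1_gt t; rewrite intrD1.
have -> : t = s + k%:~R by rewrite subrK.
rewrite mulrDr periodic_int; last exact: cosD2pi.
rewrite mulrnAl cos_mulr2n cos2sin2 => e.
have {e} sin0 : sin (pi * s) = 0.
  by apply/eqP; rewrite -sqrf_eq0; apply/eqP; lra.
have [->|sn0] := eqVneq s 0; first by rewrite add0r intr_int.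
have sgt0 : 0 < s by rewrite lt_neqAle eq_sym sn0.
have : 0 < sin (pi * s).
  by rewrite sin_gt0_pi// mulr_gt0 ?pi_gt0//= gtr_pMr ?pi_gt0.
by rewrite sin0 ltxx.
Qed.

(** * Trigonometric functions, compactness and a smooth penalty on the torus *)

Section Torus.
Context {R : realType} {n : nat}.
Implicit Types (x y : torus R n) (a b : 'I_n -> R).

(** Real and, below, imaginary part of exp(2 i pi x_i); by periodicity the chosen representative is
    immaterial. *)
Definition tcos (i : 'I_n) x : R := cos (pi *+ 2 * repr x 0 i).
Definition tsin (i : 'I_n) x : R := sin (pi *+ 2 * repr x 0 i).

Lemma repr_pi_coord (y : 'rV[R]_n) i :
  exists k : int, repr (\pi_(torus R n) y) 0 i = y 0 i + k%:~R.
Proof.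
have /torus_eqP/forallP/(_ i)/intrP[k kE] :
  \pi_(torus R n) (repr (\pi_(torus R n) y)) = \pi_(torus R n) y by rewrite reprK.
by exists k; rewrite -kE addrC subrK.
Qed.

Lemma tcos_pi i (y : 'rV[R]_n) :
  tcos i (\pi_(torus R n) y) = cos (pi *+ 2 * y 0 i).
Proof.
have [k kE] := repr_pi_coord y i.
by rewrite /tcos kE mulrDr periodic_int//; exact: cosD2pi.
Qed.

Lemma tsin_pi i (y : 'rV[R]_n) :
  tsin i (\pi_(torus R n) y) = sin (pi *+ 2 * y 0 i).
Proof.
have [k kE] := repr_pi_coord y i.
by rewrite /tsin kE mulrDr periodic_int//; exact: sinD2pi.
Qed.

(** Equal cosines and sines reduce the cosine of the difference to cos^2 + sin^2 = 1, so
    representatives differ by integers. *)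
Lemma torus_ext x y : (forall i, tcos i x = tcos i y) ->
  (forall i, tsin i x = tsin i y) -> x = y.
Proof.
move=> cxy sxy; rewrite -(reprK x) -(reprK y).
apply/torus_eqP/forallP => i; apply: cos_2pi_eq1.
have := cxy i; have := sxy i; rewrite /tcos /tsin mulrBr cosB => -> ->.
by rewrite -!expr2 cos2Dsin2.
Qed.

(** Test functions for the viscosity inequalities: rich enough to contain the doubling penalty up to
    a constant. *)
Definition trig a b x : R := \sum_(i < n) (a i * tcos i x + b i * tsin i x).

Let term (p q t : R) : R := p * cos (pi *+ 2 * t) + q * sin (pi *+ 2 * t).

Let is_derive_term (p q t : R) : is_derive t 1 (term p q)
  (pi *+ 2 * (q * cos (pi *+ 2 * t) - p * sin (pi *+ 2 * t))).
Proof.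
have -> : term p q =
    p *: (cos \o ( *%R (pi *+ 2))) + q *: (sin \o ( *%R (pi *+ 2))) by [].
have dlin : is_derive t (1:R) ( *%R (pi *+ 2 : R)) (pi *+ 2).
  have -> : *%R (pi *+ 2 : R) = (pi *+ 2 : R) *: id by [].
  by apply: is_derive_eq; rewrite /GRing.scale/= mulr1.
by apply: is_derive_eq; rewrite /GRing.scale/=; ring.
Qed.

Let is_diff_coord i (y : 'rV[R]_n) :
  is_diff y (fun v : 'rV[R]_n => v 0 i) (fun v : 'rV[R]_n => v 0 i).
Proof.
have lin : linear (fun v : 'rV[R]_n => v 0 i : R) by move=> k u v; rewrite !mxE.
pose linM := GRing.isLinear.Build _ _ _ _ _ lin.
pose c : {linear 'rV[R]_n -> R} := HB.pack (fun v : 'rV[R]_n => v 0 i : R) linM.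
apply: DiffDef; first exact: differentiable_coord.
by rewrite (@diff_lin _ _ _ c)//; exact: coord_continuous.
Qed.

Let is_diff_lift_term (p q : R) i (y : 'rV[R]_n) :
  is_diff y (term p q \o (fun y : 'rV[R]_n => y 0 i))
    (fun v : 'rV[R]_n =>
      v 0 i * (pi *+ 2 * (q * cos (pi *+ 2 * y 0 i) - p * sin (pi *+ 2 * y 0 i)))).
Proof.
have dterm : differentiable (term p q) (y 0 i).
  by apply/derivable1_diffP; exact: ex_derive.
have dcoord := differentiable_coord y 0 i.
apply: DiffDef; first exact: (differentiable_comp dcoord dterm).
have ? := is_derive_term p q (y 0 i); have ? := is_diff_coord i y.
by rewrite (diff_comp dcoord dterm) diff_val diff1E// derive1E derive_val.
Qed.

Lemma torus_compact : compact (setT : set (torus R n)).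
Proof.
have -> : (setT : set (torus R n)) =
    \pi_(torus R n) @` [set v : 'rV[R]_n | forall i, `[0, 1]%classic (v ord0 i)].
  apply/seteqP; split => // x _.
  (* Fractional parts give a representative in the compact unit cube. *)
  exists (\row_i (repr x 0 i - (Num.floor (repr x 0 i))%:~R)).
    move=> i /=; rewrite mxE in_itv/= subr_ge0 floor_le/= lerBlDl.
    by have := ltW (floorD1_gt (repr x 0 i)); rewrite intrD1.
  rewrite -[RHS]reprK; apply/torus_eqP/forallP => i.
  by rewrite mxE addrAC subrr add0r rpredN intr_int.
apply: (@continuous_compact _ _ \pi_(torus R n)).
  by apply: continuous_subspaceT; exact: pi_continuous.
apply: (@rV_compact R n (fun=> `[0, 1]%classic)) => i.
exact: segment_compact.
Qed.

Let coord2pi_continuous i :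
  continuous (fun y : 'rV[R]_n => pi *+ 2 * y 0 i).
Proof.
move=> y.
apply: (@continuous_comp _ _ _ (fun y : 'rV[R]_n => y 0 i) ( *%R (pi *+ 2))).
  exact: coord_continuous.
exact: mulrl_continuous. Qed.

Lemma tcos_continuous i : continuous (tcos i).
Proof.
apply/quotient_continuous.
rewrite (_ : tcos i \o _ = cos \o (fun y : 'rV[R]_n => pi *+ 2 * y 0 i)).
  move=> y; apply: continuous_comp; first exact: coord2pi_continuous.
  exact: continuous_cos.
by apply/funext => y; exact: tcos_pi.
Qed.

Lemma tsin_continuous i : continuous (tsin i).
Proof.
apply/quotient_continuous.
rewrite (_ : tsin i \o _ = sin \o (fun y : 'rV[R]_n => pi *+ 2 * y 0 i)).
  move=> y; apply: continuous_comp; first exact: coord2pi_continuous.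
  exact: continuous_sin.
by apply/funext => y; exact: tsin_pi.
Qed.

Let torus_lift_trig a b :
  torus_lift (trig a b) = \sum_(i < n) (term (a i) (b i) \o (fun y : 'rV[R]_n => y 0 i)).
Proof.
apply/funext => y; rewrite fct_sumE; apply: eq_bigr => i _.
by rewrite tcos_pi tsin_pi.
Qed.

Let differentiable_trig a b (y : 'rV[R]_n) : differentiable (torus_lift (trig a b)) y.
Proof.
rewrite torus_lift_trig; apply: differentiable_sum => i.
have ? := is_diff_lift_term (a i) (b i) i y; exact: ex_diff.
Qed.

Let derive_trig a b (y v : 'rV[R]_n) : 'D_v (torus_lift (trig a b)) y =
  \sum_(i < n) v 0 i * (pi *+ 2 *
    (b i * cos (pi *+ 2 * y 0 i) - a i * sin (pi *+ 2 * y 0 i))).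
Proof.
have d i := is_diff_lift_term (a i) (b i) i y.
rewrite torus_lift_trig derive_sum; last first.
  by move=> i; apply: diff_derivable; have ? := d i; exact: ex_diff.
apply: eq_bigr => i _; have ? := d i.
by rewrite deriveE ?diff_val//; exact: ex_diff.
Qed.

Lemma C1_trig a b : C1 (trig a b).
Proof.
split=> [y|v]; first exact: differentiable_trig.
have /funext -> := fun w => derive_trig a b w v.
apply: continuous_big => [|i _ y]; first exact: add_continuous.
(* Up to a factor, the derivative of a term is again a term, with coefficients [b i] and [- a i],
   hence differentiable. *)
pose g := *%R (v 0 i * (pi *+ 2)) \o term (b i) (- a i).
rewrite (_ : (fun z => _) = g \o (fun y : 'rV[R]_n => y 0 i)); last first.
  by apply/funext => z; rewrite /g/= /term mulNr mulrA.
apply: continuous_comp; first exact: coord_continuous.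
apply: continuous_comp; last exact: mulrl_continuous.
apply: differentiable_continuous; apply/derivable1_diffP.
have ? := is_derive_term (b i) (- a i) (y 0 i); exact: ex_derive.
Qed.

Lemma grad_trig a b x :
  grad (trig a b) x = \row_i (pi *+ 2 * (b i * tcos i x - a i * tsin i x)).
Proof.
apply/rowP => i; rewrite !mxE derive_trig (bigD1 i)//= !mxE !eqxx mul1r.
rewrite big1 ?addr0// => j ji.
by rewrite mxE (negbTE ji) mul0r.
Qed.

(* Squared distance in the embedding of the torus by the functions
   [exp(2 i pi x_i)]: a penalty for doubling the variables which, unlike the
   flat distance, is globally C^1. *)
Definition sqdist x y : R :=
  \sum_(i < n) ((tcos i x - tcos i y) ^+ 2 + (tsin i x - tsin i y) ^+ 2).

Lemma sqdist_ge0 x y : 0 <= sqdist x y.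
Proof. by apply: sumr_ge0 => i _; rewrite addr_ge0 ?sqr_ge0. Qed.

Lemma sqdist_eq0 x y : sqdist x y = 0 -> x = y.
Proof.
move=> /psumr_eq0P d0.
have {}d0 i : (tcos i x - tcos i y) ^+ 2 + (tsin i x - tsin i y) ^+ 2 = 0.
  by apply: d0 => // j _; rewrite addr_ge0 ?sqr_ge0.
apply: torus_ext => i; apply/eqP; rewrite -subr_eq0 -sqrf_eq0;
  have /eqP := d0 i; rewrite paddr_eq0 ?sqr_ge0// => /andP[]//.
Qed.

Lemma sqdistxx x : sqdist x x = 0.
Proof. by apply: big1 => i _; rewrite !subrr expr0n addr0. Qed.

Lemma sqdistC x y : sqdist x y = sqdist y x.
Proof. by apply: eq_bigr => i _; ring. Qed.

(** Since cos^2 + sin^2 = 1, each coordinate contributes the constant 2 plus cross terms linear in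
    [tcos i x] and [tsin i x]. *)
Lemma sqdist_trig k x y : k * sqdist x y =
  k * (2 * n%:R) +
  trig (fun i => - (2 * k * tcos i y)) (fun i => - (2 * k * tsin i y)) x.
Proof.
have -> : n%:R = \sum_(i < n) 1 :> R by rewrite sumr_const card_ord.
rewrite /sqdist /trig !mulr_sumr -big_split/=.
apply: eq_bigr => i _.
have cx : tcos i x ^+ 2 = 1 - tsin i x ^+ 2 by rewrite /tcos cos2sin2.
have cy : tcos i y ^+ 2 = 1 - tsin i y ^+ 2 by rewrite /tcos cos2sin2.
rewrite !sqrrB cx cy; ring.
Qed.

Lemma sqdist_continuous :
  continuous (fun p : torus R n * torus R n => sqdist p.1 p.2).
Proof.
apply: continuous_big => [|i _ p]; first exact: add_continuous.
have c1 : {for p, continuous (fun p => tcos i p.1 - tcos i p.2)}.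
  by apply: cvgB; apply: continuous_comp; (try exact: tcos_continuous);
    [exact: cvg_fst|exact: cvg_snd].
have c2 : {for p, continuous (fun p => tsin i p.1 - tsin i p.2)}.
  by apply: cvgB; apply: continuous_comp; (try exact: tsin_continuous);
    [exact: cvg_fst|exact: cvg_snd].
by apply: cvgD; apply: cvgM.
Qed.

End Torus.

(** * Convexity and homogeneity of the terms of the Hamiltonian *)

Lemma convex_function_le (R : realType) (f : R -> R) (l r s : R) :
  convex_function (setT : set R^o) f -> 0 < l < 1 ->
  f (l * r + (1 - l) * s) <= l * f r + (1 - l) * f s.
Proof.
move=> fc /andP[l0 l1].
have l01 : Itv.spec (@Itv.num_sem R) (Itv.Real `[0%Z, 1%Z]) l.
  by rewrite /Itv.spec/= /Itv.num_sem/= num_real/= in_itv/= (ltW l0) (ltW l1).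
exact: (fc (Itv.mk l01) r s (in_setT _) (in_setT _)).
Qed.

(** For 0 < r < s, [r] is the convex combination of [s] and 0 with weight r / s, and f(0) = 0, so
    f(r) <= (r / s) f(s) <= f(s). *)
Lemma convex_function_nondecreasing (R : realType) (f : R -> R) :
  convex_function (setT : set R^o) f ->
  (forall r : R, r <= 0 -> f r = 0) -> (forall r : R, 0 < r -> 0 < f r) ->
  {homo f : r s / r <= s}.
Proof.
move=> fc f0 f1 r s; rewrite le_eqVlt => /predU1P[->//|rs].
have f_ge0 t : 0 <= f t by case: (leP t 0) => [/f0->|/f1/ltW].
have [r0|r0] := leP r 0; first by rewrite f0.
have s0 := lt_trans r0 rs.
have l01 : 0 < r / s < 1 by rewrite divr_gt0//= ltr_pdivrMr// mul1r.
have := convex_function_le s 0 fc l01.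
rewrite mulr0 addr0 divfK ?gt_eqF// (f0 0)// mulr0 addr0 => /le_trans; apply.
by rewrite ler_piMl// ltW//; case/andP: l01.
Qed.

Lemma euclidean_normZ (R : realType) n (l : R) (p : 'rV[R]_n) :
  0 <= l -> euclidean_norm (l *: p) = l * euclidean_norm p.
Proof.
move=> l0; rewrite /euclidean_norm.
under eq_bigr do rewrite mxE exprMn.
by rewrite -mulr_sumr sqrtrM ?sqr_ge0// sqrtr_sqr ger0_norm.
Qed.

(** * Comparison of a subsolution with a supersolution *)

Section Comparison.
Context {R : realType} {n : nat}.
Context (m : R) (V : torus R n -> R) (f : R -> R) (u v : torus R n -> R).
Hypotheses (m_ge1 : 1 <= m) (V_cont : continuous V).
Hypothesis V_ge0 : forall x, 0 <= V x.
Hypothesis f_convex : convex_function (setT : set R^o) f.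
Hypothesis f_le0 : forall r : R, r <= 0 -> f r = 0.
Hypothesis f_gt0 : forall r : R, 0 < r -> 0 < f r.
Hypotheses (u_cont : continuous u) (v_cont : continuous v).

Let H x r (p : 'rV[R]_n) := euclidean_norm p `^ m - V x + f r.

Hypothesis u_sub : viscosity_subsolution H u.
Hypothesis v_super : viscosity_supersolution H v.
Hypothesis uv : forall x, V x = 0 -> u x <= v x.

(* At a maximum of the doubled functional, [x' |-> k/l * sqdist x' y] tests [u]
   at [x] and [y' |-> - k * sqdist x y'] tests [v] at [y]; up to constants both
   are trigonometric, and their gradients are proportional with ratio [l], so
   the gradient terms cancel by [(l N) ^ m <= l N ^ m]. *)
Let doubling_inequality (l C k : R) (x y : torus R n) : 0 < l < 1 -> 0 <= C ->
  (forall x' y', l * u x' - (1 - l) * C - v y' - k * sqdist x' y' <=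
                 l * u x - (1 - l) * C - v y - k * sqdist x y) ->
  v y <= l * u x - (1 - l) * C ->
  (1 - l) * V x <= V x - V y.
Proof.
move=> l01 C0 xy_max vu; have /andP[l0 l1] := l01.
pose au i := - (2 * (k / l) * tcos i y); pose bu i := - (2 * (k / l) * tsin i y).
pose av i := - (2 * - k * tcos i x); pose bv i := - (2 * - k * tsin i x).
have gradE : grad (trig av bv) y = l *: grad (trig au bu) x.
  apply/rowP => i; rewrite !grad_trig !mxE /au /bu /av /bv; field.
  by rewrite gt_eqF.
have := u_sub (C1_trig au bu) (x := x); rewrite /H => /(_ _)/wrap[].
  apply: (@filterE _ _ (nbhs_filter x)) => x'.
  have := xy_max x' y.
  have := sqdist_trig (k / l) x' y; have := sqdist_trig (k / l) x y.
  rewrite -/au -/bu.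
  set T := trig au bu x; set T' := trig au bu x' => e e' h.
  have {}e : k * sqdist x y = l * (k / l * (2 * n%:R) + T).
    by rewrite -e; field; rewrite gt_eqF.
  have {}e' : k * sqdist x' y = l * (k / l * (2 * n%:R) + T').
    by rewrite -e'; field; rewrite gt_eqF.
  rewrite -(ler_pM2l l0); move: h; rewrite e e'; lra.
have := v_super (C1_trig av bv) (x := y); rewrite /H => /(_ _)/wrap[].
  apply: (@filterE _ _ (nbhs_filter y)) => y'.
  have := xy_max x y'.
  have := sqdist_trig (- k) y' x; have := sqdist_trig (- k) y x.
  rewrite -/av -/bv (sqdistC y') (sqdistC y).
  lra.
rewrite gradE euclidean_normZ; last exact: ltW.
move=> Hv Hu.
have Hm : (l * euclidean_norm (grad (trig au bu) x)) `^ m <=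
    l * euclidean_norm (grad (trig au bu) x) `^ m.
  by apply: ge1r_powRZ; rewrite ?l0 ?(ltW l1) ?sqrtr_ge0.
(* Monotonicity of [f], then convexity between [u x] and [- C], where [f] vanishes. *)
have fu : f (v y) <= l * f (u x).
  apply: (le_trans (convex_function_nondecreasing f_convex f_le0 f_gt0 vu)).
  have := convex_function_le (u x) (- C) f_convex l01.
  by rewrite mulrN (f_le0 (r := - C)) ?oppr_le0// mulr0 addr0.
(* Against [l] times the subsolution inequality, the supersolution inequality leaves V(y) <= l
   V(x). *)
have : l * (euclidean_norm (grad (trig au bu) x) `^ m - V x + f (u x)) <= 0.
  by rewrite pmulr_rle0.
lra.
Qed.

(** No sequence of penalties is needed: maximizers for all [k] lie in one compact set [K] off the
    diagonal, so [sqdist] is bounded below on it, and a single large [k] is contradictory. *)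
Let comparison_scaled (l C : R) : 0 < l < 1 -> 0 <= C ->
  (forall x, - C <= u x) -> forall x, l * u x - (1 - l) * C <= v x.
Proof.
move=> l01 C0 uC z; have /andP[l0 l1] := l01.
rewrite leNgt; apply/negP => uvz.
pose D (p : torus R n * torus R n) := l * u p.1 - (1 - l) * C - v p.2.
have D_cont : continuous D.
  move=> p; apply: cvgB; last first.
    by apply: continuous_comp; [exact: cvg_snd|exact: v_cont].
  apply: cvgB; last exact: cvg_cst.
  apply: cvgM; first exact: cvg_cst.
  by apply: continuous_comp; [exact: cvg_fst|exact: u_cont].
pose E (p : torus R n * torus R n) := V p.1 - V p.2 - (1 - l) * V p.1.
have E_cont : continuous E.
  move=> p.
  have V1 : {for p, continuous (fun p => V p.1)}.
    by apply: continuous_comp; [exact: cvg_fst|exact: V_cont].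
  have V2 : {for p, continuous (fun p => V p.2)}.
    by apply: continuous_comp; [exact: cvg_snd|exact: V_cont].
  apply: cvgB; first exact: cvgB.
  by apply: cvgM; first exact: cvg_cst.
have cTT : compact (setT : set (torus R n * torus R n)).
  by rewrite -setXTT; apply: compact_setX; exact: torus_compact.
have TT0 : (setT : set (torus R n * torus R n)) !=set0 by exists (z, z).
have [pB _ DB] := compact_EVT_max TT0 cTT (continuous_subspaceT D_cont).
(* The condition on [E] is the conclusion of [doubling_inequality]; neither condition mentions
   [k]. *)
pose K := [set p | D (z, z) <= D p] `&` [set p | 0 <= E p].
have cK : compact K.
  apply: (subclosed_compact _ cTT) => //; apply: closedI.
    exact: ((continuous_closedP D).1 D_cont _ (@closed_ge R (D (z, z)))).
  exact: ((continuous_closedP E).1 E_cont _ (@closed_ge R 0)).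
(* Comparing the maximizer with (z, z), where the penalty vanishes, bounds the penalty by the
   maximum of [D]. *)
have maxK k : 0 <= k -> exists2 p, K p & k * sqdist p.1 p.2 <= D pB.
  move=> k0.
  have Dk_cont : continuous (fun p => D p - k * sqdist p.1 p.2).
    move=> p; apply: cvgB; first exact: D_cont.
    by apply: cvgM; [exact: cvg_cst|exact: sqdist_continuous].
  have [p _ pmax] := compact_EVT_max TT0 cTT (continuous_subspaceT Dk_cont).
  have Dzp : D (z, z) <= D p - k * sqdist p.1 p.2.
    by have := pmax (z, z) (in_setT _); rewrite /= sqdistxx mulr0 subr0.
  have ps : 0 <= k * sqdist p.1 p.2 by rewrite mulr_ge0 ?sqdist_ge0.
  have Dz : 0 < D (z, z) by rewrite /D/= subr_gt0.
  exists p; last by have := DB p (in_setT _); lra.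
  split; rewrite /=; first lra.
  rewrite /E subr_ge0; apply: (doubling_inequality (C := C) (k := k)) => //.
    by move=> x' y'; exact: (pmax (x', y') (in_setT _)).
  by rewrite -subr_ge0; move: Dzp Dz ps; rewrite /D; lra.
(* The case k = 0 only shows that [K] is nonempty. *)
have [p0 Kp0 _] := maxK 0 (lexx _).
have [q Kq qmin] := compact_EVT_min (ex_intro _ p0 Kp0) cK
  (continuous_subspaceT (@sqdist_continuous R n)).
(* On the diagonal, E >= 0 forces V = 0, so l u - (1 - l) C <= u <= v there, against D >= D(z, z) >
   0. *)
have q_gt0 : 0 < sqdist q.1 q.2.
  rewrite lt_neqAle sqdist_ge0 andbT eq_sym; apply/eqP => /sqdist_eq0 q12.
  move: Kq; rewrite inE /K /D /E/= -q12 => -[Dq Eq].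
  have V0 : V q.1 = 0.
    by apply/eqP; rewrite eq_le V_ge0 andbT -(pmulr_rle0 _ (_ : 0 < 1 - l)); lra.
  have := uv V0; have := uC q.1; have : 0 <= (1 - l) * (u q.1 + C).
    by rewrite mulr_ge0//; have := uC q.1; lra.
  lra.
have Bq : 0 <= D pB.
  have := DB (z, z) (in_setT _); rewrite {1}/D/=; lra.
(* This [k] makes the penalty at least [D pB + 1] throughout [K]. *)
have t_ge0 : 0 <= (D pB + 1) / sqdist q.1 q.2 by rewrite divr_ge0 ?ltW//; lra.
have [p Kp] := maxK _ t_ge0.
apply/negP; rewrite -ltNge.
apply: (@lt_le_trans _ _ (D pB + 1)); first lra.
rewrite -mulrA ler_peMr//; first lra.
by rewrite mulrC ler_pdivlMr// mul1r qmin// inE.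
Qed.

Lemma comparison x : u x <= v x.
Proof.
have [p _ pmin] := compact_EVT_min (ex_intro _ x I) torus_compact
  (continuous_subspaceT u_cont).
have uC z : - `|u p| <= u z.
  apply: (@le_trans _ _ (u p)); last exact: pmin (in_setT _).
  by rewrite lerNl -normrN ler_norm.
rewrite leNgt; apply/negP => vu.
pose C := `|u p|; pose e := u x - v x; pose A := u x + C.
have A0 : 0 <= A by have := uC x; rewrite /A /C; lra.
have e0 : 0 < e by rewrite subr_gt0.
(* With l = 1 - d the scaled bound reads u(x) - d A <= v(x), that is e <= d A; this [d] makes d A <
   e. *)
pose d := e / (2 * (e + A)).
have d01 : 0 < 1 - d < 1.
  rewrite /d; apply/andP; split; last first.
    by rewrite gtrBl divr_gt0//; lra.
  by rewrite subr_gt0 ltr_pdivrMr; lra.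
have := comparison_scaled d01 (normr_ge0 _ : 0 <= C) uC x.
have dA : d * A < e.
  rewrite /d mulrAC ltr_pdivrMr; last lra.
  by nra.
rewrite -/C; move: dA; rewrite /A /e; lra.
Qed.

End Comparison.

Theorem proposition1p4 (R : realType) (n : nat) (m : R)
    (V : torus R n -> R) (f : R -> R) (u1 u2 : torus R n -> R)
    (m_ge1 : 1 <= m)
    (V_cont : continuous V)
    (V_min : is_minimum V 0)
    (f_convex : convex_function (setT : set R^o) f)
    (f_le0 : forall r : R, r <= 0 -> f r = 0)
    (f_gt0 : forall r : R, 0 < r -> 0 < f r)
    (u1_cont : continuous u1)
    (u2_cont : continuous u2)
    (u1_sol : viscosity_solution
       (fun x r p => euclidean_norm p `^ m - V x + f r) u1)
    (u2_sol : viscosity_solution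
       (fun x r p => euclidean_norm p `^ m - V x + f r) u2)
    (u12 : forall x, minimizers V x -> u1 x = u2 x) :
  forall x, u1 x = u2 x.
Proof.
move=> x; have [_ V_ge0] := V_min; have [sub1 sup1] := u1_sol.
have [sub2 sup2] := u2_sol.
have {}u12 z : V z = 0 -> u1 z = u2 z.
  by move=> Vz; apply: u12; rewrite /minimizers/= Vz.
(* Each solution serves once as subsolution and once as supersolution. *)
apply/eqP; rewrite eq_le; apply/andP; split.
  by apply: (@comparison R n m V f) => // z /u12 ->.
by apply: (@comparison R n m V f) => // z /u12 ->.
Qed.
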